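(* The set of fertility numbers is closed under multiplication: if $f$ and $g$ are fertility numbers, then $fg$ is a fertility number.
   Context: A permutation is a permutation of a finite set of positive integers, written as a word in one-line notation (a word with distinct entries). $S_n$ denotes the set of permutations of $\{1,\ldots,n\}$. West's stack-sorting map $s$ is defined recursively: $s$ sends the empty permutation to the empty permutation, and if $\pi$ is a nonempty permutation with largest entry $m$, write $\pi=LmR$, where $L$ and $R$ are the (possibly empty) substrings of $\pi$ to the left and right of $m$; then $s(\pi)=s(L)s(R)m$. The fertility of a permutation $\pi$ is $|s^{-1}(\pi)|$, the number of preimages of $\pi$ under $s$. A nonnegative integer $f$ is a fertility number if there exists a permutation with fertility $f$. *)

(* Defs.v *)
From mathcomp Require Import all_boot.
From mathcomp Require Import classical_sets cardinality.

Set Implicit Arguments.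
Unset Strict Implicit.
Unset Printing Implicit Defensive.

Local Open Scope classical_set_scope.
Local Open Scope card_scope.

(* Permutations of a finite set of positive integers, in one-line notation. *)
Definition is_permutation (w : seq nat) : bool := uniq w && (0 \notin w).

Definition max_entry (w : seq nat) : nat := \max_(x <- w) x.

(* The recursion is on a bound [n] for the length of the word; see
   [stack_sort_nil] and [stack_sort_cat] for the defining equations. *)
Fixpoint stack_sort_rec (n : nat) (w : seq nat) : seq nat :=
  match n, w with
  | n'.+1, _ :: _ =>
      let m := max_entry w in
      let i := index m w in
      stack_sort_rec n' (take i w) ++ stack_sort_rec n' (drop i.+1 w) ++ [:: m]
  | _, _ => [::]
  end.

Definition stack_sort (w : seq nat) : seq nat := stack_sort_rec (size w) w.

Definition stack_sort_preimage (p : seq nat) : set (seq nat) :=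
  [set q | is_permutation q /\ stack_sort q = p].

Definition has_fertility (p : seq nat) (f : nat) : Prop :=
  stack_sort_preimage p #= `I_f.

Definition fertility_number (f : nat) : Prop :=
  exists p : seq nat, is_permutation p /\ has_fertility p f.

Lemma max_entry_mem (x : nat) (w : seq nat) : max_entry (x :: w) \in x :: w.
Proof.
rewrite /max_entry; elim: w x => [|y w IHw] x; first by rewrite big_seq1 mem_head.
rewrite big_cons; case: leqP => _; last exact: mem_head.
by rewrite inE IHw orbT.
Qed.

Lemma stack_sort_recE (n : nat) (w : seq nat) :
  size w <= n -> stack_sort_rec n w = stack_sort w.
Proof.
move=> len; rewrite /stack_sort.
suff indep k : size w <= k -> stack_sort_rec n w = stack_sort_rec k w by exact: indep.
elim: n k w len => [|n IHn] [|k] [|x w] //= len lek.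
have lti : index (max_entry (x :: w)) (x :: w) <= size w.
  by rewrite -ltnS -[X in _ < X]/(size (x :: w)) index_mem max_entry_mem.
move: lti; rewrite -[if _ then _ else _]/(index (max_entry (x :: w)) (x :: w)).
move: (index _ _) => i lti.
have st : size (take i (x :: w)) <= size w by rewrite size_take_min geq_min lti.
have sd : size (drop i w) <= size w by rewrite size_drop leq_subr.
by congr (_ ++ (_ ++ _)); apply: IHn; rewrite ?(leq_trans st) ?(leq_trans sd).
Qed.

Lemma stack_sort_nil : stack_sort [::] = [::].
Proof. by []. Qed.

Lemma stack_sort_cat (l r : seq nat) (m : nat) :
  all (gtn m) l -> all (gtn m) r ->
  stack_sort (l ++ m :: r) = stack_sort l ++ stack_sort r ++ [:: m].
Proof.
move=> /allP ltl /allP ltr.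
have maxE : max_entry (l ++ m :: r) = m.
  apply/eqP; rewrite /max_entry eqn_leq; apply/andP; split.
    apply/bigmax_leqP_seq => x; rewrite mem_cat inE.
    by case/or3P => [/ltl/ltnW|/eqP->|/ltr/ltnW].
  by apply: leq_bigmax_seq; rewrite // mem_cat mem_head orbT.
have mNl : m \notin l by apply/negP => /ltl /=; rewrite ltnn.
have idx : index m (l ++ m :: r) = size l.
  by rewrite index_cat (negbTE mNl) /= eqxx addn0.
rewrite {1}/stack_sort.
have -> : size (l ++ m :: r) = (size l + size r).+1 by rewrite size_cat /= addnS.
have stepE n w : w != [::] -> stack_sort_rec n.+1 w =
    let i := index (max_entry w) w in
    stack_sort_rec n (take i w) ++ stack_sort_rec n (drop i.+1 w) ++ [:: max_entry w].
  by case: w.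
rewrite stepE; last by case: (l).
rewrite maxE idx /= take_size_cat //.
have -> : drop (size l).+1 (l ++ m :: r) = r by rewrite -cat_rcons drop_size_cat ?size_rcons.
by rewrite !stack_sort_recE ?leq_addl ?leq_addr.
Qed.

(* Main.v *)
Require Import Defs.
From mathcomp Require Import all_boot.
From mathcomp Require Import finmap.
From mathcomp Require Import classical_sets cardinality.

(** The product of two fertilities is realised by a single word.  Let [t] and
    [s] be nonempty permutations, every entry of [t] exceeding every entry of
    [s], and let [m] exceed all of them.  A preimage of [t s m] has the form
    [l m r] with [stack_sort l ++ stack_sort r = t ++ s], so one has to see
    where [t s] can be cut.  A stack-sorted word ends with its largest entry
    ([last_stack_sort_gt]).  If the cut fell inside [t], then [stack_sort r]
    would contain entries of [t] but end with an entry of [s]; if it fell inside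
    [s], the same would happen to [stack_sort l].  Hence [stack_sort l = t] and
    [stack_sort r = s] ([stack_sort_cut]), and the preimages of [t s m] are in
    bijection with the pairs formed by a preimage of [t] and one of [s]
    ([has_fertility_cat]).

    Fertility depends only on the relative order of the entries, so adding a
    constant to the entries of a given permutation ([has_fertility_shift])
    places them above those of the other.  The empty permutation escapes the
    argument, but its fertility is 1. *)

Local Open Scope classical_set_scope.
Local Open Scope card_scope.

(** * Permutations and stack-sorted words *)

Lemma is_permutation_shift (k : nat) (p : seq nat) :
  is_permutation p -> is_permutation (map (addn k) p).
Proof.
move=> /andP[Up p0]; rewrite /is_permutation map_inj_uniq ?Up; last exact: addnI.
apply: contra p0 => /mapP[x xp /esym/eqP].
by rewrite addn_eq0 => /andP[_ /eqP <-].
Qed.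

Lemma all_gtn_notin (m : nat) (u : seq nat) : all (gtn m) u -> m \notin u.
Proof. by move=> /allP ltu; apply/negP => /ltu /=; rewrite ltnn. Qed.

Lemma is_permutation_node (l r : seq nat) (m : nat) :
  is_permutation l -> is_permutation r -> l != [::] ->
  {in l & r, forall x y, y < x} -> all (gtn m) l -> all (gtn m) r ->
  is_permutation (l ++ m :: r).
Proof.
move=> /andP[Ul l0] /andP[Ur r0] lN gt_lr ltl ltr.
have m_gt0 : 0 < m.
  by case: (l) lN ltl => // x l' _ /andP[/= + _]; exact: leq_ltn_trans.
rewrite /is_permutation cat_uniq mem_cat inE /= !negb_or Ul Ur l0 r0.
rewrite !all_gtn_notin // [0 == m]eq_sym -lt0n m_gt0 !andbT.
apply/hasPn => x xr; apply/negP => xl.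
by have := gt_lr x x xl xr; rewrite ltnn.
Qed.

Lemma perm_is_permutation (p q : seq nat) :
  perm_eq p q -> is_permutation p = is_permutation q.
Proof.
by move=> eq_pq; rewrite /is_permutation (perm_uniq eq_pq) (perm_mem eq_pq).
Qed.

(** Induction along the recursive definition of the stack-sorting map. *)
Lemma max_split_ind (P : seq nat -> Prop) :
  P [::] ->
  (forall l m r, all (gtn m) l -> all (gtn m) r -> uniq l -> uniq r ->
     P l -> P r -> P (l ++ m :: r)) ->
  forall w, uniq w -> P w.
Proof.
move=> P0 Pcat w; move: {2}(size w) (leqnn (size w)) => n.
elim: n w => [|n IHn] w; first by rewrite leqn0 size_eq0 => /eqP->.
case: w => [//|x w] len Uw.
have le_max y : y \in x :: w -> y <= max_entry (x :: w).
  by move=> yw; apply: leq_bigmax_seq.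
have : max_entry (x :: w) \in x :: w by exact: max_entry_mem.
move: (x :: w) (max_entry _) len Uw le_max => {x}w m len Uw le_max mw.
case/splitPr: mw len Uw le_max => l r.
rewrite size_cat /= addnS ltnS cat_uniq /= negb_or.
move=> len /and3P[Ul /andP[mNl _] /andP[mNr Ur]] le_max.
have lt_max u : {subset u <= l ++ m :: r} -> m \notin u -> all (gtn m) u.
  move=> sub mNu; apply/allP => y yu /=; rewrite ltn_neqAle le_max ?sub // andbT.
  by apply: contraNneq mNu => <-.
apply: Pcat => //.
- by apply: lt_max => // y yl; rewrite mem_cat yl.
- by apply: lt_max => // y yr; rewrite mem_cat inE yr !orbT.
- by apply: IHn => //; apply: leq_trans len; apply: leq_addr.
- by apply: IHn => //; apply: leq_trans len; apply: leq_addl.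
Qed.

Lemma perm_stack_sort (w : seq nat) : uniq w -> perm_eq (stack_sort w) w.
Proof.
elim/max_split_ind => [//|l m r ltl ltr _ _ IHl IHr].
rewrite stack_sort_cat // perm_cat // perm_sym -cat1s perm_catC.
by rewrite perm_cat2r perm_sym.
Qed.

Lemma stack_sort_shift (k : nat) (w : seq nat) :
  uniq w -> stack_sort (map (addn k) w) = map (addn k) (stack_sort w).
Proof.
elim/max_split_ind => [//|l m r ltl ltr _ _ IHl IHr].
have ltk u : all (gtn m) u -> all (gtn (k + m)) (map (addn k) u).
  by move=> ltu; rewrite all_map; apply: sub_all ltu => y /=; rewrite ltn_add2l.
by rewrite map_cat /= !stack_sort_cat ?ltk // IHl IHr !map_cat.
Qed.

(** The recursion writes the largest entry of [q] last, so in any cut of the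
    sorted word that maximum ends the right part. *)
Lemma last_stack_sort_gt (q u v : seq nat) (x : nat) :
  uniq q -> stack_sort q = u ++ v -> x \in u -> v != [::] -> x < last x v.
Proof.
move=> Uq; case/lastP: v => [//|v y]; rewrite last_rcons => eq_uv xu _.
move: eq_uv; elim/max_split_ind: q / Uq => [|l m r ltl ltr Ul Ur _ _].
  by move/(congr1 size); rewrite size_cat size_rcons addnS.
rewrite stack_sort_cat // cats1 -!rcons_cat => /rcons_inj[eq_uv <-].
have : x \in stack_sort l ++ stack_sort r by rewrite eq_uv mem_cat xu.
rewrite mem_cat !(perm_mem (perm_stack_sort _ _)) //.
by case/orP => [/(allP ltl)|/(allP ltr)].
Qed.

(** Both words on the left end with their maximum, whereas a cut elsewhere than
    between [t] and [s] would leave on one side a word that contains an entry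
    of [t] and ends with a smaller entry, taken from [s]. *)
Lemma stack_sort_cut (l r t s : seq nat) :
  uniq l -> uniq r -> t != [::] -> s != [::] ->
  {in t & s, forall x y, y < x} ->
  stack_sort l ++ stack_sort r = t ++ s -> stack_sort l = t /\ stack_sort r = s.
Proof.
move=> Ul Ur t0 s0 gt_ts eq_ts.
have last_mem x v : v != [::] -> last x v \in v.
  by case: v => //= y v _; exact: mem_last.
case: (ltngtP (size (stack_sort l)) (size t)) => [lt|gt|eq_size].
- (* The cut falls inside [t]. *)
  have eq_t : t = stack_sort l ++ drop (size (stack_sort l)) t.
    rewrite -{1}(cat_take_drop (size (stack_sort l)) t); congr (_ ++ _).
    by rewrite -(takel_cat s) ?(ltnW lt) // -eq_ts take_size_cat.
  have eq_r : stack_sort r = drop (size (stack_sort l)) t ++ s.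
    have := congr1 (drop (size (stack_sort l))) eq_ts.
    by rewrite drop_size_cat // drop_cat lt.
  case: (drop _ t) eq_t eq_r => [|x d] eq_t eq_r.
    by move: lt; rewrite eq_t cats0 ltnn.
  have xt : x \in t by rewrite eq_t mem_cat mem_head orbT.
  have := last_stack_sort_gt _ _ _ _ Ur eq_r (mem_head x d) s0.
  by rewrite ltnNge ltnW // gt_ts // last_mem.
- (* The cut falls inside [s]. *)
  have eq_l : stack_sort l = t ++ drop (size t) (stack_sort l).
    rewrite -{1}(cat_take_drop (size t) (stack_sort l)); congr (_ ++ _).
    by rewrite -(takel_cat (stack_sort r)) ?(ltnW gt) // eq_ts take_size_cat.
  have eq_s : s = drop (size t) (stack_sort l) ++ stack_sort r.
    have := congr1 (drop (size t)) eq_ts.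
    by rewrite drop_cat gt drop_size_cat.
  have d0 : drop (size t) (stack_sort l) != [::].
    by rewrite -size_eq0 size_drop subn_eq0 -ltnNge.
  have [x xt] : exists x, x \in t.
    by case: (t) t0 => // x t' _; exists x; exact: mem_head.
  have := last_stack_sort_gt _ _ _ _ Ul eq_l xt d0.
  by rewrite ltnNge ltnW // gt_ts // eq_s mem_cat last_mem.
- by move/eqP: eq_ts; rewrite eqseq_cat // => /andP[/eqP -> /eqP ->].
Qed.

(** * Fertility *)

Lemma has_fertility_nil (f : nat) : has_fertility [::] f -> f = 1.
Proof.
rewrite /has_fertility.
have -> : stack_sort_preimage [::] = [set [::]].
  apply/seteqP; split => [q [/andP[Uq _] q0]|_ ->]; last by [].
  by apply/eqP; rewrite -size_eq0 -(perm_size (perm_stack_sort q Uq)) q0.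
by move=> /card_esym f1; apply/card_eq_II; exact: card_eq_trans f1 card_set1.
Qed.

(** Stack-sorting commutes with the shift, and every preimage of a shifted word
    is itself a shift because it has the same entries; subtracting [k] from them
    cannot produce the entry 0, which [p] does not have. *)
Lemma has_fertility_shift (k : nat) (p : seq nat) (f : nat) :
  is_permutation p -> has_fertility p f -> has_fertility (map (addn k) p) f.
Proof.
move=> /andP[Up p0]; apply: card_eq_trans.
suff -> : stack_sort_preimage (map (addn k) p) =
          map (addn k) @` stack_sort_preimage p.
  by apply: inj_card_eq => q r _ _; apply: inj_map; exact: addnI.
apply/seteqP; split => [q [/andP[Uq q0] eq_q]|_ [q [/andP[Uq q0] <-] <-]].
- have mem_q : q =i map (addn k) p.
    by move=> x; rewrite -eq_q (perm_mem (perm_stack_sort q Uq)).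
  have qE : q = map (addn k) (map (subn^~ k) q).
    rewrite -map_comp -[LHS]map_id; apply/eq_in_map => x /=.
    by rewrite mem_q => /mapP[y _ ->]; rewrite addKn.
  exists (map (subn^~ k) q) => //.
  have Uq' : uniq (map (subn^~ k) q) by move: Uq; rewrite {1}qE => /map_uniq.
  split; last first.
    by apply: (inj_map (@addnI k)); rewrite -stack_sort_shift // -qE.
  rewrite /is_permutation Uq'; apply: contra p0 => /mapP[x].
  by rewrite mem_q => /mapP[y yp ->]; rewrite addKn => ->.
- split; last by rewrite stack_sort_shift.
  by apply: is_permutation_shift; apply/andP.
Qed.

Lemma card_eq_setX (T U : choiceType) (A : set T) (B : set U) (m n : nat) :
  A #= `I_m -> B #= `I_n -> A `*` B #= `I_(m * n).
Proof.
move=> Am Bn.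
have fA : finite_set A by exists m.
have fB : finite_set B by exists n.
have [X XE] := (iffLR finite_fsetP) (finite_setX fA fB).
rewrite XE; apply/card_eq_fsetP.
have <- := card_fset_set Am; have <- := card_fset_set Bn.
have -> : X = [fset x in [seq (a, b) | a <- fset_set A, b <- fset_set B]]%fset.
  apply/fsetP => -[a b]; rewrite -{1}(set_fsetK X) -XE fset_setX // !inE /=.
  by apply/andP/allpairsP => [[aA bB]|[[a' b'] [/= aA bB [-> ->]]]] //; exists (a, b).
rewrite card_fseq undup_id ?size_allpairs //.
by apply: allpairs_uniq => // -[a b] [a' b'].
Qed.

(** A preimage of [t s m] is determined by what stands on either side of [m],
    and by [stack_sort_cut] the two sides are an arbitrary preimage of [t] and
    an arbitrary preimage of [s]. *)
Lemma has_fertility_cat (t s : seq nat) (m f g : nat) :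
  t != [::] -> s != [::] -> {in t & s, forall x y, y < x} ->
  all (gtn m) t -> all (gtn m) s ->
  has_fertility t f -> has_fertility s g ->
  has_fertility (t ++ s ++ [:: m]) (f * g).
Proof.
move=> t0 s0 gt_ts ltt lts Ft Fs.
apply: card_eq_trans (card_eq_setX _ _ _ _ _ _ Ft Fs).
pose node (lr : seq nat * seq nat) := lr.1 ++ m :: lr.2.
have perm_pre p q : stack_sort_preimage p q -> p =i q.
  by move=> [/andP[Uq _] <-]; apply: perm_mem; exact: perm_stack_sort.
have lt_pre p q : all (gtn m) p -> stack_sort_preimage p q -> all (gtn m) q.
  by move=> ltp /perm_pre eq_pq; rewrite -(eq_all_r eq_pq).
suff -> : stack_sort_preimage (t ++ s ++ [:: m]) =
          node @` (stack_sort_preimage t `*` stack_sort_preimage s).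
  (* [m] occurs only once, so its position gives the length of the left side. *)
  apply: inj_card_eq => -[l r] [l' r'] /set_mem[/= tl _] /set_mem[/= tl' _].
  have idx q v : stack_sort_preimage t q -> index m (q ++ m :: v) = size q.
    move=> /(lt_pre _ _ ltt)/all_gtn_notin mNq.
    by rewrite index_cat (negbTE mNq) /= eqxx addn0.
  rewrite /node /= => eq_node.
  have eq_size : size l = size l' by rewrite -(idx l r) // eq_node idx.
  by move/eqP: eq_node; rewrite eqseq_cat // eqseq_cons => /and3P[/eqP-> _ /eqP->].
apply/seteqP; split => [q [/andP[Uq q0] eq_q]|_ [[l r] [/= tl sr] <-]].
- move: q0 eq_q; elim/max_split_ind: q / Uq => [_ eq_q|l m' r ltl ltr Ul Ur _ _].
    by case: (t) t0 eq_q.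
  rewrite mem_cat inE !negb_or => /and3P[l0 _ r0].
  rewrite stack_sort_cat // !cats1 -!rcons_cat => /rcons_inj[eq_lr ->].
  have [tl sr] := stack_sort_cut _ _ _ _ Ul Ur t0 s0 gt_ts eq_lr.
  by exists (l, r) => //; split; split=> //; apply/andP.
- have ltl := lt_pre _ _ ltt tl; have ltr := lt_pre _ _ lts sr.
  have [[Pl eq_l] [Pr eq_r]] := (tl, sr).
  split; last by rewrite /node stack_sort_cat // eq_l eq_r.
  apply: is_permutation_node => //.
    by apply: contraNneq t0 => /= l0; rewrite -eq_l /= l0.
  by move=> x y; rewrite -(perm_pre _ _ tl) -(perm_pre _ _ sr); exact: gt_ts.
Qed.

Theorem theorem3p1 (f g : nat) :
  fertility_number f -> fertility_number g -> fertility_number (f * g).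
Proof.
move=> [t [Pt Ft]] [s [Ps Fs]].
have [t0|t0] := eqVneq t [::].
  by move: Ft; rewrite t0 => /has_fertility_nil ->; rewrite mul1n; exists s.
have [s0|s0] := eqVneq s [::].
  by move: Fs; rewrite s0 => /has_fertility_nil ->; rewrite muln1; exists t.
pose k := max_entry s.
have le_max w x : x \in w -> x <= max_entry w.
  by move=> xw; apply: leq_bigmax_seq.
have gt_ts : {in map (addn k) t & s, forall x y, y < x}.
  move=> _ y /mapP[x xt ->] /le_max le_y; apply: leq_ltn_trans le_y _.
  (* Entries of [t] are positive, so the shift by [k] puts them strictly above [k]. *)
  rewrite -[X in X < _]addn0 ltn_add2l lt0n.
  by case/andP: Pt => _; apply: contraNneq => <-.
pose m := (k + max_entry t).+1.
exists (map (addn k) t ++ s ++ [:: m]).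
have ltt : all (gtn m) (map (addn k) t).
  by apply/allP => _ /mapP[x /le_max le_x ->] /=; rewrite ltnS leq_add2l.
have lts : all (gtn m) s.
  by apply/allP => x /le_max le_x /=; rewrite ltnS (leq_trans le_x) ?leq_addr.
have Pt' := is_permutation_shift k t Pt.
have t0' : map (addn k) t != [::] by case: (t) t0.
split; last by apply: has_fertility_cat => //; exact: has_fertility_shift.
rewrite (perm_is_permutation _ (map (addn k) t ++ m :: s)).
  exact: is_permutation_node.
by rewrite perm_cat2l cats1 perm_rcons.
Qed.
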